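(* Let $n \geq 2$ be an integer and let $p$ be the smallest prime divisor of $n$. If $\frac{n}{p}$ has fewer than $p$ distinct prime divisors, then $n$ is nice.
   Context: Two congruences $a \pmod{b}$ and $a' \pmod{b'}$ overlap if there is an integer $x$ with $x \equiv a \pmod{b}$ and $x \equiv a' \pmod{b'}$. A finite set of congruences $\{a_1 \pmod{d_1}, \ldots, a_t \pmod{d_t}\}$ with pairwise distinct moduli $1 \leq d_1 < \cdots < d_t$ is called good if whenever two distinct congruences $a_i \pmod{d_i}$ and $a_j \pmod{d_j}$ of the set overlap, we have $\gcd(d_i,d_j)=1$. A positive integer $n$ is called nice if there exist integers $a_d$, one for each divisor $d$ of $n$ with $d>1$, such that $\{a_d \pmod{d} : d \mid n, d>1\}$ is a good set of congruences. *)

(* Defs.v *)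
(* MathComp *)
From mathcomp Require Import all_boot all_order all_algebra.

Set Implicit Arguments.
Unset Strict Implicit.
Unset Printing Implicit Defensive.

(* The pair (a, d) stands for the congruence a (mod d). *)
Notation congruence := (int * nat)%type.

Definition overlap (c c' : congruence) : Prop :=
  exists x : int,
    (x = c.1 %[mod c.2%:Z])%Z /\ (x = c'.1 %[mod c'.2%:Z])%Z.

(* A finite set of congruences is given by an enumeration s. Since the moduli
   are pairwise distinct, distinct congruences of the set are distinct pairs. *)
Definition good (s : seq congruence) : Prop :=
  [/\ forall c, c \in s -> 1 <= c.2,
      uniq [seq c.2 | c <- s] &
      forall c c', c \in s -> c' \in s -> c != c' -> overlap c c' ->
        gcdn c.2 c'.2 = 1].

Definition nice (n : nat) : Prop :=
  0 < n /\
  exists a : nat -> int, good [seq (a d, d) | d <- divisors n & 1 < d].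

(* Main.v *)
(* List the primes of n as p_1 < ... < p_k and attach to a divisor d the cyclic
   successor map on its set of primes. Two divisors whose successor maps agree on
   a nonempty common set of primes have the same primes, since a cycle is the
   orbit of any of its elements. For q ^ e exactly dividing d, the residue of a_d
   modulo q ^ e is j * q ^ (e - 1), where p_j is the successor of q in d. As
   1 <= j <= k, with k <= q, and k < q if q ^ 2 divides n, the congruences of d
   and d' can overlap at a common prime q only if both the exponents of q and the
   successors of q agree. *)
Require Import Defs.
From mathcomp Require Import all_boot all_order all_algebra.

Lemma chinese_seq (T : eqType) (m r : T -> nat) (s : seq T) :
  uniq s -> {in s &, forall q q', q != q' -> coprime (m q) (m q')} ->
  exists x, all (fun q => x == r q %[mod m q]) s.
Proof.
elim: s => [|q s IHs] /=; first by exists 0.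
move=> /andP[qNs Us] co_m.
have [q1 q2 s1 s2|x /allP xP] := IHs Us.
  by apply: co_m; rewrite inE ?s1 ?s2 orbT.
have co_q : coprime (m q) (\prod_(q' <- s) m q').
  rewrite big_seq; elim/big_ind: _ => [|a b coa cob|q' q's]; first exact: coprimen1.
    by rewrite coprimeMr coa.
  apply: co_m; rewrite ?inE ?eqxx ?q's ?orbT //.
  by apply: contraNneq qNs => ->.
exists (chinese (m q) (\prod_(q' <- s) m q') (r q) x).
rewrite chinese_modl // eqxx /=; apply/allP => q' q's.
rewrite -(eqP (xP q' q's)); apply/eqP.
have dv : m q' %| \prod_(q' <- s) m q' by rewrite (big_rem q') //= dvdn_mulr.
by rewrite -[LHS](modn_dvdm _ dv) chinese_modr // modn_dvdm.
Qed.

(** Every element of [s] is reached from [x] by iterating [next s]. Along this orbit [next s] agrees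
    with [next s'], which preserves [s'], so the orbit stays in [s']. *)
Lemma sub_next (T : eqType) (s s' : seq T) (x : T) :
  uniq s -> x \in s -> x \in s' ->
  {in s, forall y, y \in s' -> next s y = next s' y} -> {subset s <= s'}.
Proof.
move=> Us xs xs' nextE y ys.
(* After rotating [s] to start at [x], its list of elements is the trajectory of [x] under
   [next s]. *)
have [i ->] : exists i, y = iter i (next s) x.
  have /rot_to[i t rot_s] := xs.
  have : fcycle (next s) (x :: t).
    by rewrite -rot_s rot_cycle; apply: cycle_next.
  rewrite /= rcons_path => /andP[/fpathP[k tE] _].
  move: ys; rewrite -(mem_rot i) rot_s tE -trajectS => /trajectP[j _ ->].
  by exists j.
have /andP[] : (iter i (next s) x \in s) && (iter i (next s) x \in s').
  elim: i => [|i /andP[is_ is']] /=; first by rewrite xs.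
  by rewrite mem_next is_ nextE // mem_next is'.
by [].
Qed.

(** For equal exponents, cancelling [q ^ e.-1] leaves a congruence modulo [q], and 1, ..., [q]
    represent distinct classes. If [e < e'], the right side vanishes modulo [q ^ e], but the left
    does not as [0 < i < q]; the digit [q] has to be excluded only here. *)
Lemma eq_modn_digit (q e e' i j : nat) :
  0 < e -> 0 < e' -> 0 < i <= q -> 0 < j <= q ->
  (e != e' -> i < q /\ j < q) ->
  i * q ^ e.-1 = j * q ^ e'.-1 %[mod q ^ minn e e'] -> e = e' /\ i = j.
Proof.
wlog le_ee' : e e' i j / e <= e'.
  move=> IH; case/orP: (leq_total e e') => le_ee'; first exact: IH.
  move=> e0 e'0 ib jb lt_q E.
  have [||->->] // := IH e' e j i le_ee' e'0 e0 jb ib.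
    by move=> ne; have [|-> ->] // := lt_q; rewrite eq_sym.
  by rewrite minnC.
move=> e0 e'0 /andP[i0 iq] /andP[j0 jq] lt_q.
rewrite (minn_idPl le_ee').
have q0 : 0 < q by apply: leq_trans iq.
have qe : q ^ e = q * q ^ e.-1 by rewrite -expnS prednK.
case: (eqVneq e e') => [<-|ne].
  move/eqP; rewrite qe -!muln_modl eqn_pmul2r ?expn_gt0 ?q0 // => /eqP E; split=> //.
  case: (ltngtP i q) iq => // [iq _|iq _]; case: (ltngtP j q) jq => // [jq _|jq _].
  - by move: E; rewrite !modn_small.
  - by move: E; rewrite jq modnn modn_small // => i_0; rewrite i_0 in i0.
  - by move: E; rewrite iq modnn modn_small // => j_0; rewrite -j_0 in j0.
  - by rewrite iq jq.
have [iq' _] := lt_q ne.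
have lt_ee' : e <= e'.-1 by rewrite -ltnS prednK // ltn_neqAle ne.
move/eqP; have -> : j * q ^ e'.-1 %% q ^ e = 0.
  by apply/eqP/dvdn_mull/dvdn_exp2l.
rewrite qe -muln_modl muln_eq0 expn_eq0 [q == 0]eqn0Ngt q0 /= orbF modn_small //.
by rewrite eqn0Ngt i0.
Qed.

Lemma eqz_mod_dvdn (x y : int) (m d : nat) :
  m %| d -> (x = y %[mod d%:Z])%Z -> (x = y %[mod m%:Z])%Z.
Proof.
move=> md /eqP; rewrite eqz_mod_dvd => dxy; apply/eqP; rewrite eqz_mod_dvd.
exact: dvdz_trans dxy.
Qed.

Lemma mem_primes_divn (n q r : nat) :
  0 < n -> prime q -> q %| n ->
  (r \in primes n) = (r == q) || (r \in primes (n %/ q)).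
Proof.
move=> n0 pq qn; have q0 := prime_gt0 pq.
have nq0 : 0 < n %/ q by rewrite divn_gt0 // dvdn_leq.
by rewrite -{1}(divnK qn) primesM // (primes_prime pq) inE orbC.
Qed.

Lemma size_primes_divn (n q : nat) :
  0 < n -> prime q -> q %| n -> size (primes n) <= (size (primes (n %/ q))).+1.
Proof.
move=> n0 pq qn.
rewrite -[_.+1]/(size (q :: primes (n %/ q))); apply: uniq_leq_size.
  exact: primes_uniq.
by move=> r; rewrite (mem_primes_divn _ q) // inE.
Qed.

(** Dividing by the smallest prime p loses at most one prime, so n has at most p primes, which
    suffices if p < q. If p = q, then [q ^ 2 %| n] ensures that no prime is lost. *)
Lemma size_primes_lt (n q : nat) :
  0 < n -> size (primes (n %/ pdiv n)) < pdiv n -> prime q -> q ^ 2 %| n ->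
  size (primes n) < q.
Proof.
move=> n0 hp pq q2n.
have qn : q %| n by apply: dvdn_trans q2n; rewrite dvdn_exp.
have n1 : 1 < n by apply: leq_trans (prime_gt1 pq) (dvdn_leq n0 qn).
have le_pq := pdiv_min_dvd (prime_gt1 pq) qn.
have le_k := size_primes_divn _ _ n0 (pdiv_prime n1) (pdiv_dvd n).
case: (ltngtP (pdiv n) q) le_pq => // [lt_pq _|pE _].
  exact: leq_ltn_trans (leq_trans le_k hp) lt_pq.
have m0 : 0 < n %/ q by rewrite divn_gt0 ?prime_gt0 // dvdn_leq.
rewrite pE in hp; apply: leq_ltn_trans hp; apply: uniq_leq_size; first exact: primes_uniq.
move=> r; rewrite (mem_primes_divn _ q) // => /orP[/eqP ->|//].
rewrite mem_primes pq m0 /=.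
by rewrite -(@dvdn_pmul2r q) ?prime_gt0 // divnK.
Qed.

Definition prime_residue (n d q : nat) : nat :=
  (index (next (primes d) q) (primes n)).+1 * q ^ (logn q d).-1.

Lemma exists_prime_residue (n d : nat) :
  exists x, all (fun q => x == prime_residue n d q %[mod q ^ logn q d]) (primes d).
Proof.
apply: chinese_seq; first exact: primes_uniq.
move=> q q'; rewrite !mem_primes => /and3P[pq _ _] /and3P[pq' _ _] ne.
by rewrite coprimeXl // coprimeXr // prime_coprime // dvdn_prime2.
Qed.

Lemma eq_prime_residue (n d d' q : nat) :
  0 < n -> size (primes (n %/ pdiv n)) < pdiv n -> d %| n -> d' %| n ->
  q \in primes d -> q \in primes d' ->
  prime_residue n d q = prime_residue n d' q
    %[mod q ^ minn (logn q d) (logn q d')] ->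
  logn q d = logn q d' /\ next (primes d) q = next (primes d') q.
Proof.
move=> n0 hp dn d'n qd qd' E.
have next_mem b : b %| n -> q \in primes b -> next (primes b) q \in primes n.
  move=> bn qb; have : next (primes b) q \in primes b by rewrite mem_next.
  rewrite !mem_primes n0 /= => /and3P[-> _ /=] /dvdn_trans; exact.
have le_logn b : b %| n -> logn q b <= logn q n by apply: dvdn_leq_log.
have := qd; rewrite mem_primes => /and3P[pq _ q_d].
have qn := dvdn_trans q_d dn.
have n1 : 1 < n by apply: leq_trans (prime_gt1 pq) (dvdn_leq n0 qn).
have le_kq : size (primes n) <= q.
  apply: leq_trans (pdiv_min_dvd (prime_gt1 pq) qn).
  exact: leq_trans (size_primes_divn _ _ n0 (pdiv_prime n1) (pdiv_dvd n)) hp.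
have ltn_index b : b %| n -> q \in primes b ->
    index (next (primes b) q) (primes n) < size (primes n).
  by move=> bn qb; rewrite index_mem next_mem.
(* Equal digits are equal positions in [primes n], from which [nth] recovers the successors. *)
have [|||||-> [] /(congr1 (nth 0 (primes n)))] := eq_modn_digit _ _ _ _ _ _ _ _ _ _ E.
- by rewrite logn_gt0.
- by rewrite logn_gt0.
- exact: leq_trans (ltn_index d _ _) le_kq.
- exact: leq_trans (ltn_index d' _ _) le_kq.
(* Of two distinct positive exponents the larger is at least 2. *)
- move=> ne; have q2n : q ^ 2 %| n.
    rewrite pfactor_dvdn //; move: ne (le_logn _ dn) (le_logn _ d'n) qd qd'.
    rewrite -!logn_gt0; case: (ltngtP (logn q d) (logn q d')) => // lt _ l l' g g'.
      by apply: leq_trans l'; apply: leq_trans lt.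
    by apply: leq_trans l; apply: leq_trans lt.
  have lt_kq := size_primes_lt _ _ n0 hp pq q2n.
  by split; apply: leq_ltn_trans lt_kq; apply: ltn_index.
by rewrite !nth_index ?next_mem.
Qed.

Theorem theorem2 (n : nat) (hn : 2 <= n)
  (hp : size (primes (n %/ pdiv n)) < pdiv n) : nice n.
Proof.
have n0 : 0 < n by apply: ltnW.
split=> //; pose x d := xchoose (exists_prime_residue n d).
exists (fun d => Posz (x d)); split.
- by move=> _ /mapP[d + ->]; rewrite mem_filter => /andP[/ltnW].
- by rewrite -map_comp map_id filter_uniq // divisors_uniq.
move=> _ _ /mapP[d + ->] /mapP[d' + ->] /=; rewrite !mem_filter -!dvdn_divisors //.
move=> /andP[d1 dn] /andP[d'1 d'n] ne [y /= [yd yd']].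
apply/eqP; apply: contraNT ne => gcd_ne1; suff -> : d = d' by [].
(* A common prime of [d] and [d'] is the starting point of the cycle argument. *)
pose r := pdiv (gcdn d d').
have d0 : 0 < d := ltnW d1; have d'0 : 0 < d' := ltnW d'1.
have pr : prime r by rewrite pdiv_prime // ltn_neqAle eq_sym gcd_ne1 gcdn_gt0 d0.
have := pdiv_dvd (gcdn d d'); rewrite dvdn_gcd => /andP[r_d r_d'].
have rd : r \in primes d by rewrite mem_primes pr d0.
have rd' : r \in primes d' by rewrite mem_primes pr d'0.
have agree q : q \in primes d -> q \in primes d' ->
    logn q d = logn q d' /\ next (primes d) q = next (primes d') q.
  move=> qd qd'; apply: (eq_prime_residue n) => //.
  have residueE b (qb : q \in primes b) : x b = prime_residue n b q %[mod q ^ logn q b].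
    by apply/eqP; apply: (allP (xchooseP (exists_prime_residue n b))).
  have dvd_min b : minn (logn q d) (logn q d') <= logn q b ->
      q ^ minn (logn q d) (logn q d') %| q ^ logn q b by apply: dvdn_exp2l.
  (* Modulo the smaller of the two powers of [q], both prescribed residues are congruent to the
     common element [y]. *)
  have dvd_d := dvd_min d (geq_minl _ _); have dvd_d' := dvd_min d' (geq_minr _ _).
  rewrite -(modn_dvdm _ dvd_d) -residueE // modn_dvdm //.
  rewrite -[RHS](modn_dvdm _ dvd_d') -residueE // modn_dvdm //.
  apply/eqP; rewrite -eqz_nat -!modz_nat; apply/eqP.
  rewrite -(eqz_mod_dvdn _ _ _ _ (dvdn_trans dvd_d (pfactor_dvdnn _ _)) yd).
  by rewrite (eqz_mod_dvdn _ _ _ _ (dvdn_trans dvd_d' (pfactor_dvdnn _ _)) yd').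
have eq_pr : primes d =i primes d'.
  move=> q; apply/idP/idP.
    apply: (sub_next _ _ _ r) => //; first exact: primes_uniq.
    by move=> z zd zd'; have [] := agree z zd zd'.
  apply: (sub_next _ _ _ r) => //; first exact: primes_uniq.
  by move=> z zd' zd; have [_ ->] := agree z zd zd'.
(* Valuations agree at the common primes by [agree], and both are zero at all others. *)
apply: eqn_from_log => // q.
case: (boolP (q \in primes d)) => qd; first by have [] := agree q qd; rewrite -?eq_pr.
have qd' : q \notin primes d' by rewrite -eq_pr.
by move: qd qd'; rewrite -!logn_gt0 -!eqn0Ngt => /eqP-> /eqP->.
Qed.
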